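(* There exist absolute constants $\delta_0 > 0$ and $C > 0$ such that the following holds. Let $N \geq 1$ be an integer, let $x_1, \dots, x_N \in \mathbb{T}$ and let $0 < \delta \leq \delta_0$. Suppose that $$ \frac{1}{N} \# \left\{ (m,n) : 1 \leq m, n \leq N,\ m \neq n,\ |x_m - x_n| \leq \frac{s}{N} \right\} \leq (1+\delta)\,2s \qquad \text{for all real } s \text{ with } 1 \leq s \leq \frac{8}{\delta}\sqrt{\log N}. $$ Then the discrepancy $D_N$ of $x_1,\dots,x_N$ satisfies $$ D_N \leq C\left( \delta^{1/3} + \delta^{-1/2} N^{-1/3}\right). $$
   Context: $\mathbb{T} = \mathbb{R}/\mathbb{Z}$ is the one-dimensional torus, identified with $[0,1]$ with endpoints glued. For $x,y \in \mathbb{T}$, $|x-y|$ denotes the distance on the torus, i.e. the distance from $x-y$ to the nearest integer. Pairs $(m,n)$ are ordered, and points are counted by index. The discrepancy of $x_1,\dots,x_N$ is $$ D_N = \sup_{I \subset \mathbb{T}} \left| \frac{\#\{1 \leq n \leq N : x_n \in I\}}{N} - |I| \right|, $$ where the supremum ranges over all intervals (arcs) $I \subset \mathbb{T}$ and $|I|$ is the length of $I$. $\log$ is the natural logarithm. *)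

(* Defs.v *)
From HB Require Import structures.
From mathcomp Require Import all_boot all_order all_algebra.
From mathcomp Require Import all_classical all_reals all_analysis.
Set Implicit Arguments.
Unset Strict Implicit.
Unset Printing Implicit Defensive.
Import Order.TTheory GRing.Theory Num.Theory.
Local Open Scope classical_set_scope.
Local Open Scope ring_scope.

(* A point of R/Z is given by a real representative; everything below depends
   only on classes modulo 1 (see [dist_intDz] and [arcDz]). *)

Definition dist_int (R : realType) (t : R) : R :=
  inf [set `|t - k%:~R| | k in [set: int]].

Lemma dist_intDz (R : realType) (t : R) (k : int) :
  dist_int (t + k%:~R) = dist_int t.
Proof.
rewrite /dist_int; congr inf; apply/seteqP; split => _ [j _ <-].
  by exists (j - k)=> //; rewrite intrB opprB addrA addrAC.
by exists (j + k)=> //; rewrite intrD opprD addrACA subrr addr0.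
Qed.

Definition torus_dist (R : realType) (x y : R) : R := dist_int (x - y).

(* Image in R/Z of the real interval [i], as a 1-periodic set. *)
Definition arc (R : realType) (i : interval R) : set R :=
  [set x | exists k : int, x + k%:~R \in i].

Lemma arcDz (R : realType) (i : interval R) (x : R) (k : int) :
  arc i (x + k%:~R) <-> arc i x.
Proof.
split=> -[j]; rewrite -?addrA -?intrD => ij; first by exists (k + j).
by exists (j - k); rewrite /= -addrA -intrD [(k + _)%R]addrC subrK.
Qed.

Definition close_pairs (R : realType) (N : nat) (x : 'I_N -> R) (r : R) : nat :=
  #|[pred p : 'I_N * 'I_N | (p.1 != p.2) && (torus_dist (x p.1) (x p.2) <= r)]|.

Definition points_in (R : realType) (N : nat) (x : 'I_N -> R) (A : set R) : nat :=
  #|[pred n : 'I_N | x n \in A]|.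

(* The booleans [c] and [d] make each endpoint open or closed.  The bound
   b <= a + 1 ensures that the interval from a to b wraps at most once around
   R/Z, so that the length of its arc is b - a. *)
Definition local_discrepancies (R : realType) (N : nat) (x : 'I_N -> R) : set R :=
  [set e | exists (a b : R) (c d : bool), a <= b <= a + 1 /\
     e = `|(points_in x (arc (Interval (BSide c a) (BSide d b))))%:R / N%:R
           - (b - a)|].

Definition discrepancy (R : realType) (N : nat) (x : 'I_N -> R) : R :=
  sup (local_discrepancies x).

(* [sup] is a junk value on sets without a supremum; this is never the case
   here. *)
Lemma has_sup_local_discrepancies (R : realType) (N : nat) (x : 'I_N -> R) :
  has_sup (local_discrepancies x).
Proof.
split.
  by eexists; exists 0, 0, true, true; split; last reflexivity; rewrite lexx add0r ler01.
exists 1 => _ [a [b [c [d [/andP[ab ba] ->]]]]].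
set k := points_in _ _.
have kN : (k <= N)%N by rewrite -[leqRHS]card_ord max_card.
have k0 : 0 <= k%:R / N%:R :> R by rewrite divr_ge0.
have k1 : k%:R / N%:R <= 1 :> R.
  have [->|N0] := posnP N; first by rewrite invr0 mulr0.
  by rewrite ler_pdivrMr ?ltr0n// mul1r ler_nat.
rewrite ler_norml; apply/andP; split.
  by rewrite lerBrDr (le_trans _ k0)// addrC subr_le0 lerBlDl.
by rewrite lerBlDr (le_trans k1)// lerDl subr_ge0.
Qed.

(* Main.v *)
Require Import Defs.
From HB Require Import structures.
From mathcomp Require Import all_boot all_order all_algebra.
From mathcomp Require Import all_classical all_reals all_analysis.
From mathcomp Require Import zify ring lra.
Import Order.TTheory GRing.Theory Num.Theory.
Local Open Scope ring_scope.

(* Round each point to the grid (1/N) Z/Z and replace it by a block of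
   k = floor(1/delta) consecutive grid points.  The number F(j) of blocks
   containing j has mean k over j in Z/N, and the sum of the F(j)^2 counts pairs
   of points weighted by the triangular function of their distance, that is, sums
   over r < k the number of pairs at distance at most r on the grid, hence at most
   (r + 1)/N on the torus.  The hypothesis at s = 1, ..., k thus bounds the
   variance of F by 4 k.  An arc containing A points has k A <= sum of F over an
   arc longer by O(k/N), so A is at most N |I| + O(k) + O(N / sqrt k); the lower
   bound follows by passing to the complementary arc.  This gives a discrepancy of
   O(1/(delta N) + sqrt delta), which is stronger than required. *)

(** * Multiples of [N] in windows of integers *)

Lemma sum_dvdz_subr (N : nat) (u : int) : (0 < N)%N ->
  (\sum_(j < N) (N%:Z %| (u - j%:Z)%R)%Z = 1)%N.
Proof.
move=> N0; have u0 : (0 <= u %% N%:Z)%Z by rewrite modz_ge0; lia.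
have uN : (`|(u %% N%:Z)%Z| < N)%N by have := @ltz_pmod u N%:Z N0; lia.
rewrite (bigD1 (Ordinal uN)) //= big1 => [|j].
  rewrite addn0; apply/eqP; rewrite eqb1 -eqz_mod_dvd gez0_abs //.
  by rewrite modz_mod.
rewrite -val_eqE /= => jN; apply/eqP; rewrite eqb0 -eqz_mod_dvd.
by rewrite [(j%:Z %% _)%Z]modz_small; have := ltn_ord j; lia.
Qed.

(** The window has at most [N] terms, so it extends to [N] consecutive integers, exactly one of
    which is a multiple of [N]. *)
Lemma sum_dvdz_window_le1 (N r : nat) (u : int) : (r.*2 < N)%N ->
  (\sum_(i < r.*2.+1) (N%:Z %| (u + (i%:Z - r%:Z))%R)%Z <= 1)%N.
Proof.
move=> rN; rewrite -(@sum_dvdz_subr N (r%:Z - u)); last exact: leq_ltn_trans rN.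
rewrite (big_ord_widen _ (fun i => nat_of_bool (N%:Z %| (u + (i%:Z - r%:Z))%R)%Z) rN).
rewrite big_mkcond leq_sum // => i _; case: ifP => // _.
rewrite (_ : u + _ = - (r%:Z - u - i%:Z)); first by rewrite dvdzE abszN -dvdzE.
by rewrite !opprB addrCA addrC.
Qed.

(* A difference c with |c| < k arises from k - |c| pairs, that is, as often as
   there are radii r < k with |c| <= r. *)
Lemma sum_sub_ord (k : nat) (g : int -> nat) :
  (\sum_(i < k) \sum_(i' < k) g (i%:Z - i'%:Z)%R =
   \sum_(r < k) \sum_(i < r.*2.+1) g (i%:Z - r%:Z)%R)%N.
Proof.
elim: k => [|k IH]; first by rewrite !big_ord0.
(* The new pairs, with i = k or i' = k, realise each difference from -k to k exactly once. *)
rewrite !big_ord_recr /= -IH.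
under eq_bigr => i _ do rewrite big_ord_recr /=.
rewrite big_split /= -addnA; congr addn.
rewrite -addnn big_split_ord /= -addnA; congr addn.
transitivity (\sum_(i < k.+1) g (k%:Z - i%:Z)%R)%N; first by rewrite big_ord_recr.
transitivity (\sum_(i < k.+1) g ((k + i)%N%:Z - k%:Z)%R)%N; last first.
  by rewrite big_ord_recr.
rewrite (reindex_inj rev_ord_inj) /=; apply: eq_bigr => i _; congr g.
by have := ltn_ord i; lia.
Qed.

(** * Block multiplicities and their second moment *)

(** This is F(j). The grid positions [y n] stay unreduced integers, and divisibility tests equality
    in Z/N. *)
Definition multiplicity {I : finType} (N k : nat) (y : I -> int) (j : nat) : nat :=
  \sum_n \sum_(i < k) (N%:Z %| (y n + i%:Z - j%:Z)%R)%Z.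

Lemma sum_multiplicity (I : finType) (N k : nat) (y : I -> int) : (0 < N)%N ->
  (\sum_(j < N) multiplicity N k y j = #|I| * k)%N.
Proof.
move=> N0; rewrite exchange_big -sum_nat_const /=; apply: eq_bigr => n _.
rewrite exchange_big /= -[RHS](card_ord k) -sum1_card; apply: eq_bigr => i _.
exact: sum_dvdz_subr.
Qed.

Lemma sum_multiplicity_sqr (I : finType) (N k : nat) (y : I -> int) : (0 < N)%N ->
  (\sum_(j < N) multiplicity N k y j ^ 2 =
   \sum_m \sum_n \sum_(i < k) \sum_(i' < k)
     (N%:Z %| (y m - y n + (i%:Z - i'%:Z))%R)%Z)%N.
Proof.
move=> N0; pose d (n : I) (i : 'I_k) (j : 'I_N) : nat :=
  (N%:Z %| (y n + i%:Z - j%:Z)%R)%Z.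
have sq (j : 'I_N) : (multiplicity N k y j ^ 2 =
    \sum_m \sum_n \sum_(i < k) \sum_(i' < k) d m i j * d n i' j)%N.
  rewrite -mulnn big_distrl; apply: eq_bigr => m _ /=.
  rewrite big_distrr; apply: eq_bigr => n _ /=.
  by rewrite big_distrl; apply: eq_bigr => i _; rewrite big_distrr.
rewrite (eq_bigr _ (fun j _ => sq j)).
rewrite exchange_big; apply: eq_bigr => m _ /=.
rewrite exchange_big; apply: eq_bigr => n _ /=.
rewrite exchange_big; apply: eq_bigr => i _ /=.
rewrite exchange_big; apply: eq_bigr => i' _ /=.
(* The factor 1 becomes a sum over j: for given i and i', only the residue of [y m + i] can be a
   common grid point. *)
rewrite -[RHS]muln1 -(sum_dvdz_subr _ (y m + i%:Z) N0) big_distrr /=.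
apply: eq_bigr => j _; rewrite /d.
have -> : y m - y n + (i%:Z - i'%:Z) = (y m + i%:Z - j%:Z) - (y n + i'%:Z - j%:Z).
  by lia.
case: (boolP (_ %| (y m + i%:Z - j%:Z)%R)%Z) => [dm|_]; last by rewrite muln0.
by rewrite muln1 mul1n; congr nat_of_bool; apply/esym/(rpredBl _ dm).
Qed.

(** For each r < k the window has fewer than [N] terms, so every pair contributes at most 1. The
    diagonal thus gives k #|I|; off it, a pair counts only if [P r] holds. *)
Lemma sum_multiplicity_sqr_le (I : finType) (N k : nat) (y : I -> int)
    (P : nat -> rel I) : (k.*2 <= N)%N ->
  (forall r m n (c : int), (`|c| <= r)%N ->
     (N%:Z %| y m - y n + c)%Z -> P r m n) ->
  (\sum_(j < N) multiplicity N k y j ^ 2 <= k * #|I| +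
   \sum_(r < k) #|[pred p : I * I | (p.1 != p.2) && P r p.1 p.2]|)%N.
Proof.
have [->|k0] := posnP k.
  by move=> _ _; rewrite big1 // => j _; rewrite /multiplicity big1 // => n _; rewrite big_ord0.
move=> kN PP; rewrite sum_multiplicity_sqr; last by lia.
under eq_bigr => m _.
  under eq_bigr => n _.
    rewrite (sum_sub_ord k (fun c => nat_of_bool (N%:Z %| y m - y n + c)%Z)).
    over.
  rewrite exchange_big /=; over.
have -> : (k * #|I| = \sum_(r < k) #|I|)%N by rewrite sum_nat_const card_ord.
rewrite exchange_big -big_split leq_sum //= => r _.
have -> : (#|[pred p : I * I | (p.1 != p.2) && P r p.1 p.2]| =
    \sum_m \sum_n ((m != n) && P r m n : nat))%N.
  by rewrite pair_bigA /= -sum1_card big_mkcond; apply: eq_bigr => p _; rewrite inE; case: (_ && _).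
rewrite -sum1_card -big_split leq_sum //= => m _.
rewrite [leqRHS]addnC [X in (_ <= X + _)%N](bigD1 m) //= eqxx add0n [leqRHS]addnC.
rewrite (bigD1 m) //= leq_add //.
  by apply: sum_dvdz_window_le1; have := ltn_ord r; lia.
rewrite leq_sum // => n nm; rewrite (eq_sym m) nm /=.
case: (boolP (P r m n)) => [_|nP].
  by apply: sum_dvdz_window_le1; have := ltn_ord r; lia.
rewrite leqn0 sum_nat_eq0; apply/forallP => i; apply/implyP => _.
rewrite eqb0; apply: contra nP; apply: PP.
by have := ltn_ord i; lia.
Qed.

(** J consists of the residues of u, ..., u + L - 1. It contains the whole block of each point of
    [A], which therefore contributes k to the sum. *)
Lemma multiplicity_block (I : finType) (N k L : nat) (y : I -> int) (u : int)
    (A : pred I) : (0 < N)%N ->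
  (forall n, A n -> exists2 p : nat, (p + k <= L)%N &
     (N%:Z %| y n - (u + p%:Z))%Z) ->
  exists2 J : {set 'I_N}, (#|J| <= L)%N &
    (k * #|A| <= \sum_(j in J) multiplicity N k y j)%N.
Proof.
move=> N0 yA.
exists [set j : 'I_N | [exists i : 'I_L, (N%:Z %| u + i%:Z - j%:Z)%Z]].
  rewrite -sum1_card big_mkcond /=.
  apply: (@leq_trans (\sum_(j < N) \sum_(i < L) (N%:Z %| (u + i%:Z - j%:Z)%R)%Z)%N).
    apply: leq_sum => j _; rewrite inE; case: existsP => // -[i ij].
    by rewrite (bigD1 i) //= ij.
  rewrite exchange_big /=; under eq_bigr => i _ do rewrite sum_dvdz_subr //.
  by rewrite sum1_card card_ord.
rewrite exchange_big /= mulnC -sum_nat_const big_mkcond /= leq_sum // => n _.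
case: ifP => // /yA[p pL yp].
rewrite exchange_big /= -[leqLHS](card_ord k) -sum1_card leq_sum // => i _.
rewrite -(@sum_dvdz_subr N (y n + i%:Z) N0) [leqRHS]big_mkcond leq_sum //= => j _.
case: ifP => // jJ; rewrite leqn0 eqb0; apply/negP => ynij.
move/negP: jJ; apply; rewrite inE; apply/existsP.
have piL : (p + i < L)%N by have := ltn_ord i; lia.
exists (Ordinal piL) => /=.
have -> : u + (p + i)%N%:Z - j%:Z = y n + i%:Z - j%:Z - (y n - (u + p%:Z)) by lia.
exact: rpredB ynij yp.
Qed.

(* AM-GM in each term, as a substitute for Cauchy-Schwarz. *)
Lemma sum_le_sqr_average (R : realFieldType) (T : finType) (f : T -> R)
    (J : {set T}) (c : R) : 0 < c ->
  \sum_(j in J) f j <= ((\sum_j f j ^+ 2) / c + #|T|%:R * c) / 2.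
Proof.
move=> c0.
have -> : ((\sum_j f j ^+ 2) / c + #|T|%:R * c) / 2 =
    \sum_(j : T) (f j ^+ 2 / c + c) / 2.
  by rewrite -!mulr_suml big_split /= sumr_const mulr_suml mulr_natl.
rewrite big_mkcond ler_sum //= => j _.
have fc : 0 <= f j ^+ 2 / c + c by rewrite addr_ge0 ?divr_ge0 ?sqr_ge0 ?ltW.
case: ifP => _; last by rewrite divr_ge0.
have -> : f j ^+ 2 / c = (f j / c) ^+ 2 * c by field; lra.
have {1}-> : f j = (f j / c) * c by field; lra.
have : 0 <= (f j / c - 1) ^+ 2 * c by rewrite mulr_ge0 ?sqr_ge0 ?ltW.
lra.
Qed.

(** * Variance and closed arcs on the torus *)

Lemma torus_dist_le (R : realType) (x y d : R) (l : int) :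
  `|x - y - l%:~R| <= d -> torus_dist x y <= d.
Proof.
move=> xyd; apply: le_trans xyd; apply: ge_inf; last by exists l.
by exists 0 => _ [k _ <-].
Qed.

(** The second moment is at most kN + (1 + delta) N k (k + 1). Subtracting N k^2 leaves 2kN + delta
    N k^2 + delta N k, where each of the last two terms is at most kN. *)
Lemma sum_multiplicity_variance_le (R : realType) (N k : nat) (x : 'I_N -> R)
    (delta : R) :
  (0 < N)%N -> (k.*2 <= N)%N -> 0 < delta <= 1 -> k%:R * delta <= 1 ->
  (forall r : nat, (r < k)%N ->
    (close_pairs x (r.+1%:R / N%:R))%:R <= N%:R * ((1 + delta) * (2 * r.+1%:R))) ->
  \sum_(j < N) ((multiplicity N k (fun n => Num.floor (N%:R * x n)) j)%:R - k%:R) ^+ 2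
    <= 4 * N%:R * k%:R :> R.
Proof.
move=> N0 kN /andP[d0 d1] kd close_le.
pose y (n : 'I_N) : int := Num.floor (N%:R * x n); rewrite -/y.
have N0R : 0 < N%:R :> R by rewrite ltr0n.
have sq : (\sum_(j < N) multiplicity N k y j ^ 2 <= k * N +
    \sum_(r < k) close_pairs x (r.+1%:R / N%:R))%N.
  rewrite -[X in (k * X)%N]card_ord.
  apply: (@sum_multiplicity_sqr_le _ N k y
    (fun r m n => torus_dist (x m) (x n) <= r.+1%:R / N%:R)) => //.
  (* The fractional parts lost to rounding differ by less than 1, whence r + 1 in place of r. *)
  move=> r m n c cr /dvdzP[l yl]; apply: (@torus_dist_le _ _ _ _ l).
  rewrite ler_pdivlMr // -[X in _ * X](gtr0_norm N0R) -normrM.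
  have /andP[m1 m2] := floor_itv (N%:R * x m).
  have /andP[n1 n2] := floor_itv (N%:R * x n).
  rewrite -/(y m) -/(y n) ?intrD in m1 m2 n1 n2.
  have {}yl : (y m)%:~R - (y n)%:~R + c%:~R = l%:~R * N%:R :> R.
    by rewrite -intrB -intrD yl intrM.
  have {}cr : `|c%:~R| <= r%:R :> R.
    by rewrite -intr_norm -[r%:R]/(r%:Z%:~R) ler_int; lia.
  rewrite ler_norml in cr; rewrite ler_norml -[r.+1]addn1 natrD.
  by apply/andP; split; nra.
have {}sq : \sum_(j < N) (multiplicity N k y j)%:R ^+ 2 <= k%:R * N%:R +
    N%:R * (1 + delta) * (k%:R * (k%:R + 1)) :> R.
  have -> : \sum_(j < N) (multiplicity N k y j)%:R ^+ 2 =
      (\sum_(j < N) multiplicity N k y j ^ 2)%N%:R :> R.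
    by rewrite natr_sum; apply: eq_bigr => j _; rewrite natrX.
  apply: le_trans (_ : _ <= (k * N + \sum_(r < k) close_pairs x (r.+1%:R / N%:R))%N%:R) _.
    by rewrite ler_nat.
  rewrite natrD natrM lerD2l natr_sum.
  apply: le_trans (_ : _ <= \sum_(r < k) N%:R * ((1 + delta) * (2 * r.+1%:R))) _.
    by apply: ler_sum => r _; apply: close_le.
  rewrite -!mulr_sumr -mulrA ler_pM2l // ler_pM2l; last lra.
  rewrite le_eqVlt; apply/orP; left; apply/eqP.
  elim: (k) => [|n IH]; first by rewrite big_ord0; lra.
  rewrite big_ord_recr /= mulrDr IH -!natr1; ring.
have s1 : \sum_(j < N) (multiplicity N k y j)%:R = N%:R * k%:R :> R.
  by rewrite -natr_sum sum_multiplicity // card_ord natrM.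
have -> : \sum_(j < N) ((multiplicity N k y j)%:R - k%:R) ^+ 2 =
    \sum_(j < N) (multiplicity N k y j)%:R ^+ 2 - N%:R * k%:R ^+ 2 :> R.
  under eq_bigr => j _ do rewrite sqrrB.
  rewrite big_split sumrB /= sumrMnl -mulr_suml s1 sumr_const card_ord -mulr_natl.
  by ring.
have kd2 : N%:R * k%:R * (k%:R * delta) <= N%:R * k%:R * 1 :> R.
  by rewrite ler_wpM2l // mulr_ge0.
have kd3 : N%:R * k%:R * delta <= N%:R * k%:R * 1 :> R.
  by rewrite ler_wpM2l // mulr_ge0.
lra.
Qed.

(** The first error term comes from rounding and block length, the other two from the variance;
    [eps] is the free parameter of AM-GM. *)
Lemma points_in_closed_arc_le (R : realType) (N : nat) (x : 'I_N -> R)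
    (delta eps a b : R) :
  0 < delta <= 1 -> 0 < eps -> 2 <= delta * N%:R -> a <= b ->
  (forall s : R, 1 <= s <= delta^-1 ->
    (close_pairs x (s / N%:R))%:R <= N%:R * ((1 + delta) * (2 * s))) ->
  (points_in x (Defs.arc `[a, b]))%:R / N%:R - (b - a) <=
    2 / (delta * N%:R) + 4 * delta / eps + eps / 2.
Proof.
move=> /andP[d0 d1] e0 dN ab close_le.
have N0 : (0 < N)%N by case: N dN {x close_le} => //; rewrite mulr0; lra.
have N0R : 0 < N%:R :> R by rewrite ltr0n.
have di0 : 0 < delta^-1 by rewrite invr_gt0.
(* This puts k delta between 1/2 and 1: the upper bound serves the variance, the lower one replaces
   1/k by 2 delta. *)
pose k := Num.truncn delta^-1.
have /andP[k1 k2] : k%:R <= delta^-1 < k.+1%:R by apply: truncn_itv; exact: ltW.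
have k0 : (0 < k)%N.
  by rewrite lt0n; apply: contraTneq k2 => ->; rewrite -leNgt invf_ge1.
have kR1 : 1 <= k%:R :> R by rewrite ler1n.
have kd : k%:R * delta <= 1 by rewrite -ler_pdivlMr // mul1r.
have kd2 : 1 <= 2 * (k%:R * delta).
  have : 1 < k.+1%:R * delta by rewrite -ltr_pdivrMr // mul1r.
  rewrite -natr1; nra.
have kN : (k.*2 <= N)%N.
  by rewrite -(ler_nat R) -muln2 natrM -(ler_pM2r d0); nra.
pose y (n : 'I_N) : int := Num.floor (N%:R * x n).
have var : \sum_(j < N) ((multiplicity N k y j)%:R - k%:R) ^+ 2 <= 4 * N%:R * k%:R :> R.
  apply: (@sum_multiplicity_variance_le R N k x delta) => //; first by rewrite d0.
  move=> r rk; apply: close_le; rewrite ler1n /=.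
  by apply: le_trans k1; rewrite ler_nat.
pose u := Num.floor (N%:R * a); pose v := Num.floor (N%:R * b).
have uv : u <= v by apply: le_floor; rewrite ler_pM2l.
(* Blocks start in the cells u, ..., v, so they end by v + k - 1. *)
pose L := (`|v - u| + k)%N.
have [|J JL kA] := @multiplicity_block _ N k L y u
    [pred n : 'I_N | x n \in Defs.arc `[a, b]] N0.
  move=> n /=; rewrite inE => -[l]; rewrite in_itv /= => /andP[al lb].
  have yl : Num.floor (N%:R * (x n + l%:~R)) = y n + N%:Z * l.
    by rewrite mulrDr -[N%:R]/(N%:Z%:~R) -intrM floorDrz ?intr_int // intrKfloor.
  have ul : u <= y n + N%:Z * l by rewrite -yl; apply: le_floor; rewrite ler_pM2l.
  have lv : y n + N%:Z * l <= v by rewrite -yl; apply: le_floor; rewrite ler_pM2l.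
  exists `|(y n + N%:Z * l - u)%R|%N.
    by rewrite leq_add2r -lez_nat !gez0_abs ?lerB // subr_ge0 // (le_trans ul).
  apply/dvdzP; exists (- l); rewrite gez0_abs ?subr_ge0 // [u + _]addrC subrK.
  by rewrite opprD addrA subrr add0r mulNr mulrC.
have LR : L%:R <= N%:R * (b - a) + 1 + k%:R.
  have /andP[u1 u2] := floor_itv (N%:R * a).
  have /andP[v1 v2] := floor_itv (N%:R * b).
  rewrite -/u -/v ?intrD in u1 u2 v1 v2.
  have -> : L%:R = v%:~R - u%:~R + k%:R :> R.
    rewrite /L natrD -intrB; congr (_ + _).
    by rewrite -[in RHS](gez0_abs (_ : 0 <= v - u)) // subr_ge0.
  lra.
(* With c = k eps, division by kN turns the two AM-GM terms into 2 / (k eps) and eps / 2. *)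
have ke0 : 0 < k%:R * eps by rewrite mulr_gt0 // ltr0n.
have := @sum_le_sqr_average _ _ (fun j : 'I_N => (multiplicity N k y j)%:R - k%:R) J _ ke0.
rewrite sumrB sumr_const card_ord -natr_sum -mulr_natl => sJ.
set A := points_in _ _.
have {}kA : k%:R * A%:R <= (\sum_(j in J) multiplicity N k y j)%N%:R :> R.
  by rewrite -natrM ler_nat.
have {}JL : #|J|%:R * k%:R <= L%:R * k%:R :> R by rewrite ler_pM2r ?ler_nat //; lra.
have v4 : (\sum_(j < N) ((multiplicity N k y j)%:R - k%:R) ^+ 2) / (k%:R * eps) <=
    4 * N%:R / eps.
  rewrite ler_pdivrMr //; apply: le_trans var _.
  by rewrite le_eqVlt; apply/orP; left; apply/eqP; field; lra.
have {v4 sJ JL} kAL : k%:R * A%:R <= k%:R * L%:R + 2 * N%:R / eps + N%:R * (k%:R * eps) / 2.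
  lra.
have i1 : 2 * N%:R / eps <= k%:R * (N%:R * (4 * delta / eps)).
  have -> : k%:R * (N%:R * (4 * delta / eps)) = 2 * N%:R / eps * (2 * (k%:R * delta)).
    by field; lra.
  by rewrite ler_peMr // !mulr_ge0 // ?invr_ge0 ltW.
have {kAL i1} AL : A%:R <= L%:R + N%:R * (4 * delta / eps) + N%:R * eps / 2.
  by rewrite -(@ler_pM2l _ k%:R) //; lra.
have k3 : 1 + k%:R <= N%:R * (2 / (delta * N%:R)).
  have -> : N%:R * (2 / (delta * N%:R)) = 2 / delta by field; lra.
  by rewrite ler_pdivlMr //; nra.
rewrite lerBlDr ler_pdivrMr //; lra.
Qed.

(** * From closed arcs to the discrepancy *)

Lemma le_points_in (R : realType) (N : nat) (x : 'I_N -> R) (A B : set R) :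
  (A `<=` B)%classic -> (points_in x A <= points_in x B)%N.
Proof.
by move=> AB; apply/subset_leq_card/fintype.subsetP => n; rewrite !inE => /AB.
Qed.

Lemma points_in_arc_complement (R : realType) (N : nat) (x : 'I_N -> R)
    (a b : R) (c d : bool) : a <= b <= a + 1 ->
  (N <= points_in x (Defs.arc (Interval (BSide c a) (BSide d b))) +
        points_in x (Defs.arc `[b, (a + 1)%R]))%N.
Proof.
move=> /andP[ab ba]; rewrite -[leqLHS]card_ord -cardUI.
apply: leq_trans (leq_addr _ _); apply/subset_leq_card/fintype.subsetP => n _.
rewrite !inE; apply/orP.
(* The representative x n - f lies in [a, a + 1). *)
have /andP[f1 f2] := floor_itv (x n - a); set f := Num.floor _ in f1 f2.
rewrite intrD in f2.
have [xb|xb] := leP b (x n - f%:~R).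
  by right; rewrite inE; exists (- f); rewrite in_itv /= intrN; lra.
have [xa|xa] := ltP a (x n - f%:~R).
  left; rewrite inE; exists (- f).
  by case: c; case: d; rewrite in_itv /= intrN; lra.
(* Here x n - f = a, which is the endpoint a + 1 of the closed complement. *)
by right; rewrite inE; exists (1 - f); rewrite in_itv /= intrB; lra.
Qed.

Lemma local_discrepancies_le1 (R : realType) (N : nat) (x : 'I_N -> R) (e : R) :
  local_discrepancies x e -> e <= 1.
Proof.
case=> a [b [c [d [/andP[ab ba] ->]]]]; set k := points_in _ _.
have kN : (k <= N)%N by rewrite -[leqRHS]card_ord max_card.
have k0 : 0 <= k%:R / N%:R :> R by rewrite divr_ge0.
have k1 : k%:R / N%:R <= 1 :> R.
  have [->|N0] := posnP N; first by rewrite invr0 mulr0.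
  by rewrite ler_pdivrMr ?ltr0n// mul1r ler_nat.
by rewrite ler_norml; apply/andP; split; lra.
Qed.

Lemma discrepancy_le (R : realType) (N : nat) (x : 'I_N -> R) (e : R) :
  (0 < N)%N ->
  (forall a b, a <= b -> (points_in x (Defs.arc `[a, b]))%:R / N%:R - (b - a) <= e) ->
  discrepancy x <= e.
Proof.
move=> N0 closed_le; apply: ge_sup; first exact: (has_sup_local_discrepancies _).1.
move=> _ [a [b [c [d [ab ->]]]]].
have N0R : 0 < N%:R :> R by rewrite ltr0n.
have := @points_in_arc_complement R N x a b c d ab; set A := points_in _ _; move/andP: ab => [ab ba].
rewrite -(ler_nat R) -(@ler_pM2r _ N%:R^-1) ?invr_gt0 // mulfV ?gt_eqF // natrD mulrDl.
have := closed_le _ _ ba; have := closed_le _ _ ab.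
have : A%:R / N%:R <= (points_in x (Defs.arc `[a, b]))%:R / N%:R :> R.
  rewrite ler_pM2r ?invr_gt0 // ler_nat; apply: (@le_points_in R) => t [l tl]; exists l.
  by move: tl; clear A; case: c; case: d; rewrite !in_itv /=; lra.
by move=> *; rewrite ler_norml; lra.
Qed.

(** * Choice of parameters *)

(** This makes the range of s in the hypothesis reach 1/delta. It follows from ln N >= ln 2 >=
    1/2. *)
Lemma inv8_le_sqrt_ln (R : realType) (N : nat) : (2 <= N)%N ->
  8^-1 <= Num.sqrt (ln N%:R) :> R.
Proof.
move=> N2; have l2 : ln 2 <= ln N%:R :> R.
  by rewrite ler_ln ?posrE ?ltr0n ?ler_nat //; lia.
have : ln (1 + - 2^-1) <= - 2^-1 :> R by apply: le_ln1Dx; lra.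
have -> : 1 + - 2^-1 = 2^-1 :> R by lra.
rewrite lnV ?posrE // => h.
have e0 : 0 <= (8^-1 : R) by lra.
rewrite -(ger0_norm e0) -sqrtr_sqr ler_sqrt; lra.
Qed.

Theorem theorem1 (R : realType) :
  exists delta0 C : R, 0 < delta0 /\ 0 < C /\
  forall (N : nat) (x : 'I_N -> R) (delta : R),
    (1 <= N)%N ->
    0 < delta <= delta0 ->
    (forall s : R, 1 <= s <= 8 / delta * Num.sqrt (ln N%:R) ->
      1 / N%:R * (close_pairs x (s / N%:R))%:R <= (1 + delta) * (2 * s)) ->
    discrepancy x <=
      C * (delta `^ (1 / 3) + delta `^ (- (1 / 2)) * N%:R `^ (- (1 / 3))).
Proof.
exists 1, 8; split; first exact: ltr01; split; first lra.
move=> N x delta N1 d01 close_le; have /andP[d0 d1] := d01.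
have N0R : 0 < N%:R :> R by rewrite ltr0n.
have dN0 : 0 < delta * N%:R by rewrite mulr_gt0.
set w := delta `^ (1 / 3); set v := delta `^ (- (1 / 2)); set n := N%:R `^ (- (1 / 3)).
have w0 : 0 < w by rewrite powR_gt0.
have n0 : 0 < n by rewrite powR_gt0.
have w3 : w ^+ 3 = delta.
  by rewrite -powR_mulrn ?ltW // -powRrM div1r mulVf ?pnatr_eq0 // powRr1 // ltW.
have w1 : w <= 1 by rewrite -(@expr_le1 _ 3) ?w3 // ltW.
have n3 : n ^+ 3 = N%:R^-1.
  rewrite -powR_mulrn ?ltW // -powRrM div1r mulNr mulVf ?pnatr_eq0 //.
  by rewrite powRN powRr1 // ltW.
have vw : w^-1 <= v.
  rewrite /v /w !powRN lef_pV2 ?posrE ?powR_gt0 //; apply: ger_powR; last lra.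
  by rewrite d0.
(* u = (delta N)^(-1/3) is at most the second term of the target, because delta <= 1. *)
pose u := n / w.
have u0 : 0 < u by rewrite divr_gt0.
have u3 : u ^+ 3 = (delta * N%:R)^-1 by rewrite expr_div_n n3 w3 invfM mulrC.
have uv : u <= v * n by rewrite /u mulrC ler_pM2r.
(* If delta N < 2, then u > 1/2 and the trivial bound 1 suffices. *)
have [dN|dN] := ltP (delta * N%:R) 2.
  have : 2^-1 < u ^+ 3 by rewrite u3 ltf_pV2 ?posrE.
  move=> u3_gt; have u_gt : 2^-1 < u.
    rewrite ltNge; apply/negP => u_le; nra.
  apply: (@le_trans _ _ 1); last lra.
  apply: ge_sup; first exact: (has_sup_local_discrepancies x).1.
  exact: local_discrepancies_le1.
have u1 : u <= 1.
  by rewrite -(@expr_le1 _ 3) ?(ltW u0) // u3 invf_le1 //; lra.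
have N2 : (2 <= N)%N by rewrite -(ler_nat R); nra.
have ln_ge := @inv8_le_sqrt_ln R N N2.
apply: discrepancy_le => // a b ab.
(* Taking eps = w = delta^(1/3) gives the total 2 u^3 + 4 w^2 + w / 2, which is linear in u and w
   after using u, w <= 1. *)
apply: le_trans (points_in_closed_arc_le _ _ x delta w a b d01 w0 dN ab _) _.
  move=> s /andP[s1 s2]; have := close_le s; rewrite s1 div1r ler_pdivrMl // => -> //=.
  by apply: le_trans s2 _; rewrite mulrAC ler_peMl ?invr_ge0 ?(ltW d0) //; lra.
have -> : 4 * delta / w = 4 * w ^+ 2 by rewrite -w3; field; lra.
have -> : 2 / (delta * N%:R) = 2 * u ^+ 3 by rewrite u3.
have u3_le : u ^+ 3 <= u by rewrite -[leRHS]expr1 ler_wiXn2l // ltW.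
have w2_le : w ^+ 2 <= w by rewrite -[leRHS]expr1 ler_wiXn2l // ltW.
lra.
Qed.
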